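(* Let $\nu>-1$ and let $j_{\nu,1}$ be the first positive zero of the Bessel function of the first kind $J_\nu$. Put $\alpha_\nu=\frac{j_{\nu,1}^2}{4(\nu+1)}$ and $\beta_\nu=1$. Then for all real $x$ with $|x|<j_{\nu,1}$, $$\left(\frac{j_{\nu,1}^2-x^2}{j_{\nu,1}^2}\right)^{\alpha_{\nu}}\leq\mathcal{J}_{\nu}(x)\leq\left(\frac{j_{\nu,1}^2-x^2}{j_{\nu,1}^2}\right)^{\beta_{\nu}}.$$ Moreover the constants $\alpha_\nu$ and $\beta_\nu$ are best possible: $\alpha_\nu$ is the smallest real number $\alpha$ such that $\left(\frac{j_{\nu,1}^2-x^2}{j_{\nu,1}^2}\right)^{\alpha}\le\mathcal{J}_\nu(x)$ for all $|x|<j_{\nu,1}$, and $\beta_\nu$ is the largest real number $\beta$ such that $\mathcal{J}_\nu(x)\le\left(\frac{j_{\nu,1}^2-x^2}{j_{\nu,1}^2}\right)^{\beta}$ for all $|x|<j_{\nu,1}$.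
   Context: For $\nu>-1$, $J_\nu$ is the Bessel function of the first kind, $J_\nu(x)=\sum_{n\ge0}\frac{(-1)^n}{n!\,\Gamma(\nu+n+1)}\left(\frac{x}{2}\right)^{2n+\nu}$ for $x>0$, and $j_{\nu,1}$ is its smallest positive zero. The normalized Bessel function is $\mathcal{J}_\nu(x)=\sum_{n\ge0}\frac{(-1)^n\,\Gamma(\nu+1)}{n!\,\Gamma(\nu+n+1)}\left(\frac{x}{2}\right)^{2n}$ for $x\in\mathbb{R}$; thus $\mathcal{J}_\nu(x)=2^\nu\Gamma(\nu+1)x^{-\nu}J_\nu(x)$ for $x>0$ and $\mathcal{J}_\nu(0)=1$. *)

(* Defs.v *)
From Stdlib Require Import Reals Factorial.
From Coquelicot Require Import Coquelicot.
Open Scope R_scope.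

(* Euler's integral; meaningful for s > 0 only. When nu > -1, every argument
   nu + n + 1 used below is positive. *)
Definition Gamma (s : R) : R :=
  RInt_gen (fun t => Rpower t (s - 1) * exp (- t))
    (at_right 0) (Rbar_locally p_infty).

(* Meaningful for x > 0 only, since Rpower is the real power of a positive
   base; no value at x <= 0 is used. *)
Definition BesselJ (nu x : R) : R :=
  Series (fun n : nat =>
    (-1) ^ n / (INR (fact n) * Gamma (nu + INR n + 1))
      * Rpower (x / 2) (2 * INR n + nu)).

Definition normBesselJ (nu x : R) : R :=
  Series (fun n : nat =>
    (-1) ^ n * Gamma (nu + 1) / (INR (fact n) * Gamma (nu + INR n + 1))
      * (x / 2) ^ (2 * n)).

Definition is_first_positive_zero (f : R -> R) (j : R) : Prop :=
  0 < j /\ f j = 0 /\ forall x : R, 0 < x -> f x = 0 -> j <= x.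

Definition is_smallest (P : R -> Prop) (a : R) : Prop :=
  P a /\ forall b : R, P b -> a <= b.

Definition is_largest (P : R -> Prop) (a : R) : Prop :=
  P a /\ forall b : R, P b -> b <= a.

(* Main.v *)
Require Import Defs.
From Stdlib Require Import Reals Lra Factorial.
From Coquelicot Require Import Coquelicot.
Open Scope R_scope.

(** With [c = nu + 1], [t = x ^ 2 / 4] and [T = j ^ 2 / 4], [normBesselJ nu x] is
    [F_c(t) = 0F1(; c; -t)] and [T] is the first positive zero of [F_c]. Since
    [F_c' = - F_(c+1) / c] and [(t^c F_(c+1))' = c t^(c-1) F_c], positivity of [F_c] on
    [[0, T)] passes to [F_(c+1)] and then [F_(c+2)] on [[0, T]]. Hence [F_c] is
    decreasing and convex there, with a simple zero at [T]: convexity gives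
    [F_c(t) <= 1 - t / T], and the simple zero excludes any exponent larger than 1.
    For the lower bound, a Turan inequality shows that [F_(c+2) / F_(c+1)] increases,
    which yields [F_(c+1)(t) (1 - t / T) <= F_c(t)], that is,
    [ln F_c(t) - (T / c) ln (1 - t / T)] is nondecreasing. Comparing derivatives at
    [t = 0] shows that [T / c] cannot be lowered. *)

(** * Convergence and recursion of Euler's integral *)

Lemma le_of_is_derive_nonneg (f df : R -> R) (a b : R) : a <= b ->
  (forall x, a <= x <= b -> is_derive f x (df x)) ->
  (forall x, a < x < b -> 0 <= df x) -> f a <= f b.
Proof.
intros [hab | <-] hd hp; [ | lra].
destruct (MVT_cor2 f df a b hab) as [c [e hc]].
- intros x hx; apply is_derive_Reals, hd, hx.
- specialize (hp c hc).
  assert (0 <= df c * (b - a)) by (apply Rmult_le_pos; lra); lra.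
Qed.

(** The limit is the supremum of the values on the positive half-line. The bound by [l] is kept
    because the positivity of [Gamma] rests on it. *)
Lemma nondecreasing_bounded_lim (F : R -> R) (B : R) :
  (forall x y, 0 < x -> x <= y -> F x <= F y) ->
  (forall x, 0 < x -> F x <= B) ->
  exists l, filterlim F (Rbar_locally p_infty) (locally l)
    /\ forall x, 0 < x -> F x <= l.
Proof.
intros hm hB.
destruct (completeness (fun y => exists x, 0 < x /\ y = F x)) as [l [hu hl]].
- exists B; intros y [x [hx ->]]; auto.
- exists (F 1), 1; split; [lra | reflexivity].
- exists l; split.
  + apply filterlim_locally; intros eps.
    destruct (Classical_Prop.classic (exists x, 0 < x /\ l - eps < F x))
      as [[x [hx hlt]] | hn].
    * exists x; intros y hy.
      assert (F x <= F y) by (apply hm; lra).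
      assert (F y <= l) by (apply hu; exists y; split; [lra | reflexivity]).
      apply Rabs_def1; unfold minus, plus, opp; simpl; destruct eps; simpl in *; lra.
    * exfalso.
      assert (l <= l - eps); [ | destruct eps; simpl in *; lra].
      apply hl; intros y [x [hx ->]].
      apply Rnot_lt_le; intros h; apply hn; exists x; auto.
  + intros x hx; apply hu; exists x; auto.
Qed.

(** Replacing [F x] by [- F (/ x)] preserves monotonicity and exchanges the end 0 with the end at
    infinity. *)
Lemma nondecreasing_bounded_lim_right (F : R -> R) (B : R) :
  (forall x y, 0 < x -> x <= y -> F x <= F y) ->
  (forall x, 0 < x -> B <= F x) ->
  exists l, filterlim F (at_right 0) (locally l)
    /\ forall x, 0 < x -> l <= F x.
Proof.
intros hm hB.
destruct (nondecreasing_bounded_lim (fun x => - F (/ x)) (- B)) as [l [hl hle]].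
- intros x y hx hy; apply Ropp_le_contravar, hm.
  + apply Rinv_0_lt_compat; lra.
  + apply Rinv_le_contravar; lra.
- intros x hx; apply Ropp_le_contravar, hB, Rinv_0_lt_compat, hx.
- exists (- l); split.
  + apply (filterlim_ext (fun x => - (- F (/ / x)))).
    * intros x; rewrite Rinv_inv; lra.
    * apply (filterlim_comp _ _ _ (fun x => - F (/ / x)) Ropp
        (at_right 0) (locally l) (locally (- l))).
      -- apply (filterlim_comp _ _ _ Rinv (fun x => - F (/ x))
           (at_right 0) (Rbar_locally p_infty) (locally l)).
         ++ apply filterlim_Rinv_0_right.
         ++ exact hl.
      -- apply (filterlim_opp (K := R_AbsRing) (V := R_NormedModule)).
  + intros x hx.
    specialize (hle (/ x) (Rinv_0_lt_compat x hx)); simpl in hle.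
    rewrite Rinv_inv in hle; lra.
Qed.

Lemma is_RInt_gen_antiderivative (F f : R -> R) (la lb : R) :
  (forall x, 0 < x -> is_derive F x (f x)) ->
  (forall x, 0 < x -> continuous f x) ->
  filterlim F (at_right 0) (locally la) ->
  filterlim F (Rbar_locally p_infty) (locally lb) ->
  is_RInt_gen f (at_right 0) (Rbar_locally p_infty) (lb - la).
Proof.
intros hd hc h0 h1.
(* Whatever holds on the positive half-line holds eventually on all of [[a, b]] as [a] tends to 0
   from the right and [b] to infinity, since both ends become positive. *)
assert (hp : forall P : R -> Prop, (forall x, 0 < x -> P x) ->
  filter_prod (at_right 0) (Rbar_locally p_infty)
    (fun ab : R * R => forall x,
       Rmin (fst ab) (snd ab) <= x <= Rmax (fst ab) (snd ab) -> P x)).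
{ intros P hP.
  apply (Filter_prod _ _ _ (fun a => 0 < a) (fun b => 0 < b)).
  - exists (mkposreal 1 Rlt_0_1); intros y _ hy; exact hy.
  - exists 0; auto.
  - simpl; intros a b ha hb x [hx _]; apply hP.
    revert hx; unfold Rmin; destruct (Rle_dec a b); lra. }
apply (is_RInt_gen_ext (Derive F)).
- assert (h := hp _ (fun x hx => is_derive_unique F x _ (hd x hx))).
  revert h; apply filter_imp; intros ab h x hx; apply h; lra.
- apply is_RInt_gen_Derive; auto.
  + apply (hp (ex_derive F)); intros x hx; exists (f x); auto.
  + apply (hp (continuous (Derive F))); intros x hx.
    (* [Derive F] is known to agree with [f] only at positive points; the ball of radius [x] about
       [x] stays among them. *)
    apply (continuous_ext_loc _ f); [ | auto].
    exists (mkposreal x hx); intros y hy; symmetry; apply is_derive_unique, hd.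
    apply Rabs_def2 in hy; unfold minus, plus, opp in hy; simpl in hy; lra.
Qed.

Lemma is_derive_Rpower (s x : R) : 0 < x ->
  is_derive (fun t => Rpower t s) x (s * Rpower x (s - 1)).
Proof. intros hx; apply is_derive_Reals, derivable_pt_lim_power, hx. Qed.

Lemma exp_le_1 (x : R) : x <= 0 -> exp x <= 1.
Proof.
intros [h | ->]; [ | rewrite exp_0; lra].
rewrite <- exp_0; apply Rlt_le, exp_increasing, h.
Qed.

Lemma is_derive_exp_scal (k x : R) :
  is_derive (fun t => exp (k * t)) x (k * exp (k * x)).
Proof. auto_derive; [exact I | ring]. Qed.

Lemma filterlim_Rpower_0_right (s : R) : 0 < s ->
  filterlim (fun t => Rpower t s) (at_right 0) (locally 0).
Proof.
intros hs; apply filterlim_locally; intros eps.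
exists (mkposreal (Rpower eps (/ s)) (exp_pos _)); intros t ht h0.
apply Rabs_def2 in ht; unfold minus, plus, opp in ht; simpl in ht.
assert (h : Rpower t s < Rpower (Rpower eps (/ s)) s)
  by (apply Rlt_Rpower_l; lra).
rewrite Rpower_mult, Rinv_l, Rpower_1 in h by (apply cond_pos || lra).
assert (0 < Rpower t s) by apply exp_pos.
apply Rabs_def1; unfold minus, plus, opp; simpl; destruct eps; simpl in *; lra.
Qed.

(** From [1 + ln u <= u] at [u = t / (2 * m)] comes [t ^ m <= (2 * m) ^ m * exp (t / 2)]; taking
    [m = Rmax s 1] makes [m] positive and at least [s]. The rate 1/2 leaves a decaying factor
    [exp (- t / 2)] in Euler's integrand. *)
Lemma Rpower_le_exp_half (s : R) :
  exists C, 0 < C /\ forall t, 1 <= t -> Rpower t s <= C * exp (t / 2).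
Proof.
set (m := Rmax s 1).
assert (h1 : s <= m) by apply Rmax_l.
assert (h2 : 1 <= m) by apply Rmax_r.
exists (exp (m * ln (2 * m))); split; [apply exp_pos | intros t ht].
apply Rle_trans with (Rpower t m); [apply Rle_Rpower; lra | ].
rewrite <- exp_plus; unfold Rpower.
assert (hq : 0 < t / (2 * m)) by (apply Rdiv_lt_0_compat; lra).
assert (h := exp_ineq1_le (ln (t / (2 * m)))).
rewrite exp_ln in h by exact hq.
assert (e : ln t = ln (t / (2 * m)) + ln (2 * m))
  by (rewrite <- ln_mult by lra; f_equal; field; lra).
assert (hm : m * ln (t / (2 * m)) <= m * (t / (2 * m)))
  by (apply Rmult_le_compat_l; lra).
replace (m * (t / (2 * m))) with (t / 2) in hm by (field; lra).
rewrite e.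
destruct (Rle_lt_or_eq_dec (m * (ln (t / (2 * m)) + ln (2 * m)))
  (m * ln (2 * m) + t / 2)) as [hl | ->]; [lra | | lra].
apply Rlt_le, exp_increasing, hl.
Qed.

Lemma is_derive_Gamma_integrand (s x : R) : 0 < x ->
  is_derive (fun t => Rpower t s * exp (- t)) x
    (s * (Rpower x (s - 1) * exp (- x)) - Rpower x s * exp (- x)).
Proof.
intros hx.
assert (h := is_derive_mult (fun t => Rpower t s) (fun t => exp (-1 * t)) x _ _
  (is_derive_Rpower s x hx) (is_derive_exp_scal (-1) x) Rmult_comm).
replace (- x) with (-1 * x) by ring.
apply (is_derive_ext (fun t => Rpower t s * exp (-1 * t))).
- intros t; do 2 f_equal; lra.
- evar_last; [exact h | unfold plus, mult; simpl; ring].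
Qed.

Lemma continuous_Gamma_integrand (s x : R) : 0 < x ->
  continuous (fun t => Rpower t s * exp (- t)) x.
Proof.
intros hx; apply (ex_derive_continuous (fun t => Rpower t s * exp (- t))).
eexists; apply is_derive_Gamma_integrand, hx.
Qed.

Lemma is_derive_RInt_Gamma_integrand (s x : R) : 0 < x ->
  is_derive (fun b => RInt (fun t => Rpower t s * exp (- t)) 1 b) x
    (Rpower x s * exp (- x)).
Proof.
intros hx; apply (is_derive_RInt (fun t => Rpower t s * exp (- t)) _ 1).
- exists (mkposreal x hx); intros y hy.
  apply Rabs_def2 in hy; unfold minus, plus, opp in hy; simpl in hy.
  apply (RInt_correct (fun t => Rpower t s * exp (- t))).
  apply (ex_RInt_continuous (fun t => Rpower t s * exp (- t))).
  intros z [hz _]; apply continuous_Gamma_integrand.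
  revert hz; unfold Rmin; destruct (Rle_dec 1 y); lra.
- apply continuous_Gamma_integrand, hx.
Qed.

(** The primitive [F] of the integrand based at 1 is increasing. Comparison with [C * exp (- t / 2)]
    bounds it above, comparison with [t ^ (s - 1)] bounds it below, so it has finite limits at both
    ends. *)
Lemma Gamma_converges (s : R) : 0 < s ->
  exists G, 0 < G /\ is_RInt_gen (fun t => Rpower t (s - 1) * exp (- t))
      (at_right 0) (Rbar_locally p_infty) G.
Proof.
intros hs.
set (w := fun t => Rpower t (s - 1) * exp (- t)).
set (F := (fun b => RInt w 1 b) : R -> R).
assert (hw : forall x, 0 < w x) by (intros; apply Rmult_lt_0_compat; apply exp_pos).
assert (hF : forall x, 0 < x -> is_derive F x (w x))
  by (intros; apply is_derive_RInt_Gamma_integrand; assumption).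
assert (hm : forall x y, 0 < x -> x <= y -> F x <= F y).
{ intros x y hx hxy; apply (le_of_is_derive_nonneg F w); auto.
  - intros z hz; apply hF; lra.
  - intros z _; apply Rlt_le, hw. }
assert (F1 : F 1 = 0) by exact (RInt_point 1 w).
destruct (Rpower_le_exp_half (s - 1)) as [C [hC hle]].
destruct (nondecreasing_bounded_lim F (2 * C)) as [lb [hlb hb]]; [exact hm | | ].
{ intros x hx.
  (* The exponential bound is available only from 1 on, so [x] is first moved up to at least 1. *)
  apply Rle_trans with (F (Rmax x 1)); [apply hm; [assumption | apply Rmax_l] | ].
  assert (h1 : 1 <= Rmax x 1) by apply Rmax_r.
  generalize dependent (Rmax x 1); clear x hx; intros x hx.
  assert (h : 2 * C * (1 - exp (-1/2 * 1)) - F 1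
           <= 2 * C * (1 - exp (-1/2 * x)) - F x).
  { apply (le_of_is_derive_nonneg (fun x => 2 * C * (1 - exp (-1/2 * x)) - F x)
      (fun x => C * exp (-1/2 * x) - w x)); [exact hx | | ].
    - intros z hz.
      apply (is_derive_minus (fun x => 2 * C * (1 - exp (-1/2 * x))) F);
        [ | apply hF; lra].
      auto_derive; [exact I | field].
    - intros z hz; specialize (hle z ltac:(lra)).
      assert (h := Rmult_le_compat_r (exp (- z)) _ _ (Rlt_le _ _ (exp_pos _)) hle).
      rewrite Rmult_assoc, <- exp_plus in h.
      replace (z / 2 + - z) with (-1/2 * z) in h by field.
      unfold w; lra. }
  assert (0 < C * exp (-1/2 * x)) by (apply Rmult_lt_0_compat; [lra | apply exp_pos]).
  assert (exp (-1/2 * 1) <= 1) by (apply exp_le_1; lra).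
  assert (0 <= C * (1 - exp (-1/2 * 1))) by (apply Rmult_le_pos; lra).
  lra. }
destruct (nondecreasing_bounded_lim_right F (- / s)) as [la [hla ha]]; [exact hm | | ].
{ intros x hx.
  apply Rle_trans with (F (Rmin x 1)).
  2: { apply hm; [apply Rmin_pos; lra | apply Rmin_l]. }
  assert (h1 : Rmin x 1 <= 1) by apply Rmin_r.
  assert (h0 : 0 < Rmin x 1) by (apply Rmin_pos; lra).
  generalize dependent (Rmin x 1); clear x hx; intros x hx1 hx.
  (* On [(0, 1]] the derivative of the left side is [x ^ (s - 1) * (1 - exp (- x)) >= 0]. *)
  assert (h : / s * Rpower x s - F x <= / s * Rpower 1 s - F 1).
  { apply (le_of_is_derive_nonneg (fun x => / s * Rpower x s - F x)
      (fun x => / s * (s * Rpower x (s - 1)) - w x)); [exact hx1 | | ].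
    - intros z hz.
      apply (is_derive_minus (fun x => / s * Rpower x s) F); [ | apply hF; lra].
      apply (is_derive_scal (fun x => Rpower x s)), is_derive_Rpower; lra.
    - intros z hz; rewrite <- Rmult_assoc, Rinv_l, Rmult_1_l by lra; unfold w.
      assert (exp (- z) <= 1) by (apply exp_le_1; lra).
      assert (0 <= Rpower z (s - 1) * (1 - exp (- z)))
        by (apply Rmult_le_pos; [apply Rlt_le, exp_pos | lra]).
      lra. }
  assert (e1 : Rpower 1 s = 1)
    by (unfold Rpower; rewrite ln_1, Rmult_0_r; apply exp_0).
  rewrite e1 in h.
  assert (0 < / s * Rpower x s)
    by (apply Rmult_lt_0_compat; [apply Rinv_0_lt_compat, hs | apply exp_pos]).
  lra. }
exists (lb - la); split.
(* Strict positivity: [la <= F 1 < F 2 <= lb]. *)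
- assert (F 1 < F 2); [ | specialize (ha 1 Rlt_0_1); specialize (hb 2); lra].
  rewrite F1; apply RInt_gt_0; [lra | intros; apply hw | ].
  intros x hx; apply continuous_Gamma_integrand; lra.
- apply (is_RInt_gen_antiderivative F); auto.
  intros x hx; apply continuous_Gamma_integrand, hx.
Qed.

Lemma Gamma_correct (s : R) : 0 < s ->
  is_RInt_gen (fun t => Rpower t (s - 1) * exp (- t))
    (at_right 0) (Rbar_locally p_infty) (Gamma s).
Proof.
intros hs; apply (RInt_gen_correct (V := R_CompleteNormedModule)).
destruct (Gamma_converges s hs) as [G [_ hG]]; exists G; exact hG.
Qed.

Lemma Gamma_pos (s : R) : 0 < s -> 0 < Gamma s.
Proof.
intros hs; destruct (Gamma_converges s hs) as [G [hG h]].
unfold Gamma; rewrite (is_RInt_gen_unique _ _ h); exact hG.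
Qed.

(** Integration by parts: the derivative of [t ^ s * exp (- t)] has integral 0, both boundary limits
    being 0, and subtracting it from [s] times the integrand of [Gamma s] leaves that of
    [Gamma (s + 1)]. *)
Lemma Gamma_succ (s : R) : 0 < s -> Gamma (s + 1) = s * Gamma s.
Proof.
intros hs.
assert (hp : is_RInt_gen
  (fun x => s * (Rpower x (s - 1) * exp (- x)) - Rpower x s * exp (- x))
  (at_right 0) (Rbar_locally p_infty) (0 - 0)).
{ apply (is_RInt_gen_antiderivative (fun t => Rpower t s * exp (- t))).
  - intros x hx; apply is_derive_Gamma_integrand, hx.
  - intros x hx.
    apply (continuous_minus (fun x => s * (Rpower x (s - 1) * exp (- x)))
      (fun x => Rpower x s * exp (- x))).
    + apply (continuous_scal_r s (fun x => Rpower x (s - 1) * exp (- x))),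
        continuous_Gamma_integrand, hx.
    + apply continuous_Gamma_integrand, hx.
  - apply (filterlim_le_le (F := at_right 0) (fun _ => 0) _ (fun t => Rpower t s) 0).
    + exists (mkposreal 1 Rlt_0_1); intros t _ ht; split.
      * apply Rlt_le, Rmult_lt_0_compat; apply exp_pos.
      * assert (exp (- t) <= 1) by (apply exp_le_1; lra).
        rewrite <- (Rmult_1_r (Rpower t s)) at 2.
        apply Rmult_le_compat_l; [apply Rlt_le, exp_pos | assumption].
    + apply filterlim_const.
    + apply filterlim_Rpower_0_right, hs.
  - destruct (Rpower_le_exp_half s) as [C [hC hle]].
    apply (filterlim_le_le (F := Rbar_locally p_infty)
      (fun _ => 0) _ (fun t => C * exp (-1/2 * t)) 0).
    + exists 1; intros t ht; split.
      * apply Rlt_le, Rmult_lt_0_compat; apply exp_pos.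
      * replace (-1/2 * t) with (t / 2 + - t) by field.
        rewrite exp_plus, <- Rmult_assoc; apply Rmult_le_compat_r;
          [apply Rlt_le, exp_pos | apply hle; lra].
    + apply filterlim_const.
    + assert (h : is_lim (fun t => C * exp (-1/2 * t + 0)) p_infty (Rbar_mult C 0)).
      { apply is_lim_scal_l, (is_lim_comp_lin exp); [ | lra].
        replace (Rbar_plus (Rbar_mult (-1/2) p_infty) 0) with m_infty.
        - apply is_lim_exp_m.
        - simpl; destruct (Rle_dec 0 (-1/2)); [exfalso; lra | reflexivity]. }
      simpl in h; rewrite Rmult_0_r in h.
      revert h; apply filterlim_ext; intros t; rewrite Rplus_0_r; reflexivity. }
assert (h := is_RInt_gen_minus _ _ _ _
  (is_RInt_gen_scal _ s _ (Gamma_correct s hs)) hp).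
unfold Gamma at 1.
rewrite (is_RInt_gen_unique _ (minus (scal s (Gamma s)) (0 - 0))).
- unfold minus, plus, opp, scal, mult; simpl; unfold mult; simpl; ring.
- revert h; apply is_RInt_gen_ext, filter_forall; intros ab x _.
  replace (s + 1 - 1) with s by ring.
  unfold minus, plus, opp, scal, mult; simpl; unfold mult; simpl; ring.
Qed.

(** * The hypergeometric series *)

Fixpoint pochhammer (c : R) (n : nat) : R :=
  match n with
  | O => 1
  | S m => pochhammer c m * (c + INR m)
  end.

Lemma pochhammer_pos (c : R) (n : nat) : 0 < c -> 0 < pochhammer c n.
Proof.
intros hc; induction n as [ | n IH]; simpl; [lra | ].
assert (h := pos_INR n); apply Rmult_lt_0_compat; lra.
Qed.

Lemma pochhammer_succ_l (c : R) (n : nat) :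
  pochhammer c (S n) = c * pochhammer (c + 1) n.
Proof.
induction n as [ | n IH]; [simpl; ring | ].
change (pochhammer c (S n) * (c + INR (S n))
  = c * (pochhammer (c + 1) n * (c + 1 + INR n))).
rewrite IH, S_INR; ring.
Qed.

Lemma Gamma_add_INR (s : R) (n : nat) : 0 < s ->
  Gamma (s + INR n) = Gamma s * pochhammer s n.
Proof.
intros hs; induction n as [ | n IH].
- simpl; rewrite Rplus_0_r; ring.
- assert (h := pos_INR n).
  rewrite S_INR, <- Rplus_assoc, Gamma_succ, IH by lra; simpl; ring.
Qed.

Definition hyp0F1_coef (c : R) (n : nat) : R :=
  (-1) ^ n / (INR (fact n) * pochhammer c n).

(* The hypergeometric function [0F1(; c; -t)], so that
   [normBesselJ nu x] is its value at [c = nu + 1], [t = x ^ 2 / 4]. *)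
Definition hyp0F1 (c t : R) : R := PSeries (hyp0F1_coef c) t.

(** Coefficient form of the derivative formula [F_c' = - F_(c+1) / c]. *)
Lemma hyp0F1_coef_succ (c : R) (n : nat) : 0 < c ->
  hyp0F1_coef c (S n) = - hyp0F1_coef (c + 1) n / (c * INR (S n)).
Proof.
intros hc; unfold hyp0F1_coef; rewrite pochhammer_succ_l, fact_simpl, mult_INR.
assert (h1 := INR_fact_lt_0 n); assert (h2 := pochhammer_pos (c + 1) n ltac:(lra)).
assert (h3 := pos_INR n); rewrite S_INR; simpl pow; field; lra.
Qed.

Lemma hyp0F1_coef_contiguous (c : R) (n : nat) : 0 < c ->
  hyp0F1_coef c (S n) = hyp0F1_coef (c + 1) (S n)
    - / (c * (c + 1)) * hyp0F1_coef (c + 2) n.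
Proof.
intros hc; unfold hyp0F1_coef; rewrite !pochhammer_succ_l, fact_simpl, mult_INR.
replace (c + 1 + 1) with (c + 2) by ring.
assert (e := pochhammer_succ_l (c + 1) n); simpl in e.
replace (c + 1 + 1) with (c + 2) in e by ring.
assert (h1 := INR_fact_lt_0 n); assert (h2 := pochhammer_pos (c + 2) n ltac:(lra)).
assert (h3 := pos_INR n).
replace (pochhammer (c + 1) n) with ((c + 1) * pochhammer (c + 2) n / (c + 1 + INR n))
  by (rewrite <- e; field; lra).
rewrite S_INR; simpl pow; field; lra.
Qed.

(** Consecutive coefficients have ratio [- 1 / ((c + n) * (n + 1))], of modulus at most
    [1 / (c * (n + 1))]. *)
Lemma CV_radius_hyp0F1 (c : R) : 0 < c -> CV_radius (hyp0F1_coef c) = p_infty.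
Proof.
intros hc; apply CV_radius_infinite_DAlembert.
- intros n; unfold hyp0F1_coef.
  assert (h1 := INR_fact_lt_0 n); assert (h2 := pochhammer_pos c n hc).
  apply Rmult_integral_contrapositive_currified;
    [apply pow_nonzero; lra | apply Rinv_neq_0_compat, Rgt_not_eq, Rmult_lt_0_compat; lra].
- apply (is_lim_seq_le_le (fun _ => 0) _ (fun n => / c * / INR (S n))).
  + intros n.
    assert (h1 := INR_fact_lt_0 n); assert (h2 := pochhammer_pos c n hc).
    assert (h3 := pos_INR n).
    assert (h4 : (-1) ^ n <> 0) by (apply pow_nonzero; lra).
    replace (hyp0F1_coef c (S n) / hyp0F1_coef c n)
      with (- (/ (c + INR n) * / INR (S n))).
    * rewrite Rabs_Ropp, Rabs_right.
      -- split; [apply Rlt_le, Rmult_lt_0_compat; apply Rinv_0_lt_compat; rewrite ?S_INR; lra | ].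
         apply Rmult_le_compat_r; [apply Rlt_le, Rinv_0_lt_compat; rewrite ?S_INR; lra | ].
         apply Rinv_le_contravar; lra.
      -- apply Rgt_ge, Rmult_lt_0_compat; apply Rinv_0_lt_compat; rewrite ?S_INR; lra.
    * unfold hyp0F1_coef; rewrite fact_simpl, mult_INR, S_INR; simpl pow; simpl pochhammer.
      field; lra.
  + apply is_lim_seq_const.
  + replace (Finite 0) with (Rbar_mult (/ c) 0) by (simpl; f_equal; ring).
    apply is_lim_seq_scal_l.
    apply (is_lim_seq_incr_1 (fun n => / INR n)).
    apply (is_lim_seq_inv INR p_infty); [apply is_lim_seq_INR | discriminate].
Qed.

Lemma hyp0F1_0 (c : R) : hyp0F1 c 0 = 1.
Proof. unfold hyp0F1, hyp0F1_coef; rewrite PSeries_0; simpl; field. Qed.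

Lemma is_derive_hyp0F1 (c t : R) : 0 < c ->
  is_derive (hyp0F1 c) t (- hyp0F1 (c + 1) t / c).
Proof.
intros hc; evar_last.
- apply is_derive_PSeries; rewrite CV_radius_hyp0F1; [exact I | exact hc].
- unfold hyp0F1; rewrite (PSeries_ext _ (PS_scal (- / c) (hyp0F1_coef (c + 1)))).
  + rewrite PSeries_scal; field; lra.
  + intros n; unfold PS_derive, PS_scal; rewrite hyp0F1_coef_succ by exact hc.
    assert (h := pos_INR n); rewrite S_INR.
    unfold scal; simpl; unfold mult; simpl; field; lra.
Qed.

Lemma ex_derive_hyp0F1 (c t : R) : 0 < c -> ex_derive (hyp0F1 c) t.
Proof. intros hc; eexists; apply is_derive_hyp0F1, hc. Qed.

(** This is the three-term recurrence [J_(c-1) + J_(c+1) = (2 c / x) J_c] in the variable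
    [t = x ^ 2 / 4], proved coefficient by coefficient. *)
Lemma hyp0F1_contiguous (c t : R) : 0 < c ->
  hyp0F1 c t = hyp0F1 (c + 1) t - t / (c * (c + 1)) * hyp0F1 (c + 2) t.
Proof.
intros hc; unfold hyp0F1.
rewrite (PSeries_ext _ (PS_minus (hyp0F1_coef (c + 1))
  (PS_scal (/ (c * (c + 1))) (PS_incr_1 (hyp0F1_coef (c + 2)))))).
- rewrite PSeries_minus, PSeries_scal, PSeries_incr_1.
  + field; lra.
  + apply CV_radius_inside; rewrite CV_radius_hyp0F1; [exact I | lra].
  + apply (ex_pseries_scal (K := R_AbsRing) (V := R_NormedModule)); [apply Rmult_comm | ].
    apply (ex_pseries_incr_1 (K := R_AbsRing) (V := R_NormedModule)).
    apply CV_radius_inside; rewrite CV_radius_hyp0F1; [exact I | lra].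
- intros [ | n].
  + unfold PS_minus, PS_plus, PS_opp, PS_scal, PS_incr_1, hyp0F1_coef.
    unfold plus, opp, scal, zero; simpl; unfold mult; simpl; field; lra.
  + rewrite hyp0F1_coef_contiguous by exact hc; reflexivity.
Qed.

(** * Positivity through Euler operators and the Turan inequality *)

(* [(s ^ d * phi s)' = s ^ (d - 1) * (s * phi' s + d * phi s)] on [s > 0]. *)
Lemma pos_of_euler_operator_pos (phi dphi : R -> R) (d t : R) : 0 <= t ->
  (forall s, is_derive phi s (dphi s)) -> 0 < phi 0 ->
  (forall s, 0 < s < t -> 0 < s * dphi s + d * phi s) ->
  0 < phi t.
Proof.
intros [ht | <-] hd h0 hpos; [ | exact h0].
assert (hc : forall s, continuous phi s)
  by (intros s; apply (ex_derive_continuous phi); exists (dphi s); apply hd).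
(* [Rpower] is a genuine power only for a positive base, so the mean value theorem starts at some
   [s > 0] so close to 0 that [phi s] is still positive. *)
destruct (proj1 (filterlim_locally _ _) (hc 0) (mkposreal _ h0)) as [eta heta].
set (s := Rmin (t / 2) (eta / 2)).
assert (hs : 0 < s) by (apply Rmin_pos; destruct eta; simpl; lra).
assert (hst : s <= t / 2) by apply Rmin_l.
assert (hse : s <= eta / 2) by apply Rmin_r.
assert (hphi : 0 < phi s).
{ assert (hb : Rabs (minus (phi s) (phi 0)) < phi 0).
  { apply (heta s); apply Rabs_def1; unfold minus, plus, opp; simpl;
      destruct eta; simpl in *; lra. }
  apply Rabs_def2 in hb; unfold minus, plus, opp in hb; simpl in hb; lra. }
clearbody s.
set (psi := fun r => Rpower r d * phi r).
assert (hpsi : forall r, 0 < r ->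
  is_derive psi r (Rpower r (d - 1) * (r * dphi r + d * phi r))).
{ intros r hr; evar_last.
  - apply (is_derive_mult (fun r => Rpower r d) phi r _ _
      (is_derive_Rpower d r hr) (hd r) Rmult_comm).
  - unfold plus, mult; simpl.
    replace (Rpower r d) with (Rpower r (d - 1) * r).
    + ring.
    + rewrite <- (Rpower_1 r hr) at 2; rewrite <- Rpower_plus; f_equal; ring. }
destruct (MVT_cor2 psi (fun r => Rpower r (d - 1) * (r * dphi r + d * phi r)) s t)
  as [r [e hr]]; [lra | intros r hr; apply is_derive_Reals, hpsi; lra | ].
assert (0 < Rpower r (d - 1) * (r * dphi r + d * phi r) * (t - s))
  by (repeat apply Rmult_lt_0_compat; [apply exp_pos | apply hpos; lra | lra]).
assert (0 < psi s) by (apply Rmult_lt_0_compat; [apply exp_pos | exact hphi]).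
apply (Rmult_lt_reg_l (Rpower t d)); [apply exp_pos | rewrite Rmult_0_r].
fold (psi t); lra.
Qed.

(** By contiguity, [s * d/ds + c] sends [F_(c+1)] to [c * F_c]. Positivity is needed only before
    [t], so the conclusion reaches the zero of [F_c] itself. *)
Lemma hyp0F1_succ_pos (c t : R) : 0 < c -> 0 <= t ->
  (forall s, 0 <= s < t -> 0 < hyp0F1 c s) -> 0 < hyp0F1 (c + 1) t.
Proof.
intros hc ht hpos.
apply (pos_of_euler_operator_pos (hyp0F1 (c + 1))
  (fun s => - hyp0F1 (c + 1 + 1) s / (c + 1)) c); [exact ht | | rewrite hyp0F1_0; lra | ].
- intros s; apply is_derive_hyp0F1; lra.
- intros s hs; specialize (hpos s ltac:(lra)).
  rewrite (hyp0F1_contiguous c s hc) in hpos.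
  replace (c + 1 + 1) with (c + 2) by ring.
  apply (Rmult_lt_compat_l c) in hpos; [ | exact hc].
  rewrite Rmult_0_r in hpos.
  replace (_ + _) with
    (c * (hyp0F1 (c + 1) s - s / (c * (c + 1)) * hyp0F1 (c + 2) s)) by (field; lra).
  exact hpos.
Qed.

(* With [phi] the left-hand side, [t * phi' + d * phi = t * (hyp0F1 (d + 1) t / d) ^ 2]. *)
Lemma hyp0F1_turan (d t : R) : 0 < d -> 0 <= t ->
  0 <= hyp0F1 d t ^ 2 - hyp0F1 d t * hyp0F1 (d + 1) t + t * (hyp0F1 (d + 1) t / d) ^ 2.
Proof.
(* The expression vanishes at [t = 0], whereas the positivity criterion wants a positive value
   there; hence the slack [eps]. *)
intros hd ht; apply le_epsilon; intros eps heps.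
set (A := hyp0F1 d); set (B := hyp0F1 (d + 1)); set (C := hyp0F1 (d + 2)).
set (dA := fun s => - B s / d); set (dB := fun s => - C s / (d + 1)).
assert (hA : forall s, is_derive A s (dA s)) by (intros; apply is_derive_hyp0F1, hd).
assert (hB : forall s, is_derive B s (dB s)).
{ intros s; unfold dB, C; replace (d + 2) with (d + 1 + 1) by ring.
  apply is_derive_hyp0F1; lra. }
apply Rlt_le.
apply (pos_of_euler_operator_pos
  (fun s => A s ^ 2 - A s * B s + s * (B s / d) ^ 2 + eps)
  (fun s => 2 * A s * dA s - dA s * B s - A s * dB s + (B s / d) ^ 2
    + s * (2 * (B s / d) * (dB s / d))) d t ht).
- intros s; auto_derive.
  + repeat split; try (exists (dA s); apply hA); exists (dB s); apply hB.
  + replace (Derive (fun x => A x) s) with (dA s) by (symmetry; apply is_derive_unique, hA).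
    replace (Derive (fun x => B x) s) with (dB s) by (symmetry; apply is_derive_unique, hB).
    field; lra.
- unfold A, B; rewrite !hyp0F1_0.
  replace (_ + _) with eps by ring; exact heps.
- intros s hs.
  assert (hC : A s = B s - s / (d * (d + 1)) * C s) by (apply hyp0F1_contiguous, hd).
  replace (_ + _) with (s * (B s / d) ^ 2 + d * eps).
  + assert (0 <= s * (B s / d) ^ 2) by (apply Rmult_le_pos; [lra | apply pow2_ge_0]).
    assert (0 < d * eps) by (apply Rmult_lt_0_compat; lra); lra.
  + unfold dA, dB; rewrite hC; field; lra.
Qed.

(** The numerator of the derivative of the quotient, multiplied by [r], is [d] times the Turan
    expression once contiguity eliminates [r * hyp0F1 (d + 2) r]. *)
Lemma hyp0F1_ratio_nondecreasing (d s t : R) : 0 < d -> 0 < s -> s <= t ->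
  (forall r, 0 <= r <= t -> 0 < hyp0F1 d r) ->
  hyp0F1 (d + 1) s / hyp0F1 d s <= hyp0F1 (d + 1) t / hyp0F1 d t.
Proof.
intros hd hs hst hpos.
assert (hA := fun r => is_derive_hyp0F1 d r hd).
assert (hB := fun r => is_derive_hyp0F1 (d + 1) r ltac:(lra)).
replace (d + 1 + 1) with (d + 2) in hB by ring.
apply (le_of_is_derive_nonneg (fun r => hyp0F1 (d + 1) r / hyp0F1 d r)
  (fun r => (- hyp0F1 (d + 2) r / (d + 1) * hyp0F1 d r
     - - hyp0F1 (d + 1) r / d * hyp0F1 (d + 1) r) / hyp0F1 d r ^ 2)); [exact hst | | ].
- intros r hr; specialize (hpos r ltac:(lra)).
  evar_last; [apply (is_derive_div _ _ r _ _ (hB r) (hA r)); lra | field; lra].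
- intros r hr; specialize (hpos r ltac:(lra)).
  apply Rdiv_le_0_compat; [ | apply pow_lt, hpos].
  apply (Rmult_le_reg_l r); [lra | rewrite Rmult_0_r].
  assert (h := hyp0F1_turan d r hd ltac:(lra)).
  apply (Rmult_le_compat_l d) in h; [ | lra]; rewrite Rmult_0_r in h.
  assert (e := hyp0F1_contiguous d r hd).
  assert (eC : r * hyp0F1 (d + 2) r
    = d * (d + 1) * (hyp0F1 (d + 1) r - hyp0F1 d r)) by (rewrite e; field; lra).
  replace (r * _) with (- (r * hyp0F1 (d + 2) r) * hyp0F1 d r / (d + 1)
    + r * hyp0F1 (d + 1) r ^ 2 / d) by (field; lra).
  rewrite eC; eapply Rle_trans; [exact h | right; field; lra].
Qed.

(** * Bounds before the first zero *)

(** [F_c'' = F_(c+2) / (c * (c + 1))] is positive on [[0, T]], so the graph lies below its chord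
    from [(0, 1)] to [(T, 0)]. *)
Lemma hyp0F1_upper_bound (c T t : R) : 0 < c -> hyp0F1 c T = 0 ->
  (forall s, 0 <= s < T -> 0 < hyp0F1 c s) -> 0 <= t < T ->
  hyp0F1 c t <= 1 - t / T.
Proof.
intros hc hT hpos ht.
assert (hpos1 : forall s, 0 <= s <= T -> 0 < hyp0F1 (c + 1) s)
  by (intros s hs; apply hyp0F1_succ_pos; [lra .. | intros r hr; apply hpos; lra]).
assert (hpos2 : forall s, 0 <= s <= T -> 0 < hyp0F1 (c + 1 + 1) s)
  by (intros s hs; apply hyp0F1_succ_pos; [lra .. | intros r hr; apply hpos1; lra]).
destruct ht as [[ht0 | <-] ht1]; [ | rewrite hyp0F1_0; lra].
destruct (MVT_cor2 (hyp0F1 c) (fun s => - hyp0F1 (c + 1) s / c) 0 t ht0)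
  as [x1 [e1 hx1]]; [intros; apply is_derive_Reals, is_derive_hyp0F1, hc | ].
destruct (MVT_cor2 (hyp0F1 c) (fun s => - hyp0F1 (c + 1) s / c) t T ht1)
  as [x2 [e2 hx2]]; [intros; apply is_derive_Reals, is_derive_hyp0F1, hc | ].
assert (hconv : - hyp0F1 (c + 1) x1 / c <= - hyp0F1 (c + 1) x2 / c).
{ apply (le_of_is_derive_nonneg (fun s => - hyp0F1 (c + 1) s / c)
    (fun s => hyp0F1 (c + 1 + 1) s / (c + 1) / c)); [lra | | ].
  - intros s _.
    assert (h := is_derive_hyp0F1 (c + 1) s ltac:(lra)).
    apply (is_derive_scal (hyp0F1 (c + 1)) s (- / c)) in h.
    apply (is_derive_ext (fun s => - / c * hyp0F1 (c + 1) s)); [intros r; simpl; field; lra | ].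
    evar_last; [exact h | field; lra].
  - intros s hs; specialize (hpos2 s ltac:(lra)).
    repeat apply Rmult_le_pos; try (apply Rlt_le, Rinv_0_lt_compat); lra. }
rewrite hyp0F1_0 in e1; rewrite hT in e2.
set (p := - hyp0F1 (c + 1) x1 / c) in *; set (q := - hyp0F1 (c + 1) x2 / c) in *.
apply (Rmult_le_reg_l T); [lra | ].
replace (T * (1 - t / T)) with (T - t) by (field; lra).
(* The first copy of [hyp0F1 c t] is expressed by the mean slope [p] on [[0, t]], the second by the
   mean slope [q >= p] on [[t, T]]. *)
replace (T * hyp0F1 c t) with ((T - t) * hyp0F1 c t + t * hyp0F1 c t) by ring.
replace (hyp0F1 c t) with (1 + p * t) at 1 by lra.
replace (hyp0F1 c t) with (- (q * (T - t))) by lra.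
assert (0 <= t * (T - t) * (q - p)) by (repeat apply Rmult_le_pos; lra).
lra.
Qed.

(** Convexity puts the graph above its tangent at [T]. This makes the simplicity of the zero
    quantitative, for the optimality of the exponent 1. *)
Lemma hyp0F1_linear_lower_bound (c T t : R) : 0 < c -> hyp0F1 c T = 0 ->
  (forall s, 0 <= s < T -> 0 < hyp0F1 c s) -> 0 <= t < T ->
  hyp0F1 (c + 1) T / c * (T - t) <= hyp0F1 c t.
Proof.
intros hc hT hpos ht.
assert (hpos1 : forall s, 0 <= s <= T -> 0 < hyp0F1 (c + 1) s)
  by (intros s hs; apply hyp0F1_succ_pos; [lra .. | intros r hr; apply hpos; lra]).
assert (hpos2 : forall s, 0 <= s <= T -> 0 < hyp0F1 (c + 1 + 1) s)
  by (intros s hs; apply hyp0F1_succ_pos; [lra .. | intros r hr; apply hpos1; lra]).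
destruct (MVT_cor2 (hyp0F1 c) (fun s => - hyp0F1 (c + 1) s / c) t T (proj2 ht))
  as [x [e hx]]; [intros; apply is_derive_Reals, is_derive_hyp0F1, hc | ].
assert (hdec : - hyp0F1 (c + 1) x <= - hyp0F1 (c + 1) T).
{ apply (le_of_is_derive_nonneg (fun s => - hyp0F1 (c + 1) s)
    (fun s => hyp0F1 (c + 1 + 1) s / (c + 1))); [lra | | ].
  - intros s _.
    assert (h := is_derive_opp _ _ _ (is_derive_hyp0F1 (c + 1) s ltac:(lra))).
    evar_last; [exact h | unfold opp; simpl; field; lra].
  - intros s hs; specialize (hpos2 s ltac:(lra)).
    apply Rlt_le, Rdiv_lt_0_compat; lra. }
rewrite hT in e.
replace (hyp0F1 c t) with (hyp0F1 (c + 1) x / c * (T - t)) by lra.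
repeat apply Rmult_le_compat_r; try lra.
apply Rlt_le, Rinv_0_lt_compat, hc.
Qed.

(* By contiguity [hyp0F1 c t / hyp0F1 (c + 1) t = 1 - t * u t / (c * (c + 1))], where
   [u = hyp0F1 (c + 2) / hyp0F1 (c + 1)] increases and equals [c * (c + 1) / T] at the
   zero [T] of [hyp0F1 c]. *)
Lemma hyp0F1_ge_succ (c T t : R) : 0 < c -> hyp0F1 c T = 0 ->
  (forall s, 0 <= s < T -> 0 < hyp0F1 c s) -> 0 <= t < T ->
  hyp0F1 (c + 1) t * (1 - t / T) <= hyp0F1 c t.
Proof.
intros hc hT hpos ht.
assert (hpos1 : forall s, 0 <= s <= T -> 0 < hyp0F1 (c + 1) s)
  by (intros s hs; apply hyp0F1_succ_pos; [lra .. | intros r hr; apply hpos; lra]).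
destruct ht as [[ht0 | <-] ht1]; [ | rewrite !hyp0F1_0; lra].
assert (h := hyp0F1_ratio_nondecreasing (c + 1) t T ltac:(lra) ht0 ltac:(lra) hpos1).
replace (c + 1 + 1) with (c + 2) in h by ring.
assert (eT := hyp0F1_contiguous c T hc); rewrite hT in eT.
assert (hp := hpos1 t ltac:(lra)); assert (hp' := hpos1 T ltac:(lra)).
replace (hyp0F1 (c + 2) T / hyp0F1 (c + 1) T) with (c * (c + 1) / T) in h.
2: { replace (hyp0F1 (c + 1) T) with (T / (c * (c + 1)) * hyp0F1 (c + 2) T) by lra.
     field; repeat split; try lra.
     (* If [hyp0F1 (c + 2) T] vanished, contiguity at [T] would make the positive [hyp0F1 (c + 1) T]
        vanish too. *)
     intros e; rewrite e in eT; lra. }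
rewrite (hyp0F1_contiguous c t hc).
replace (hyp0F1 (c + 1) t - _) with (hyp0F1 (c + 1) t
  * (1 - t / (c * (c + 1)) * (hyp0F1 (c + 2) t / hyp0F1 (c + 1) t))) by (field; lra).
apply Rmult_le_compat_l; [lra | apply Rplus_le_compat_l, Ropp_le_contravar].
replace (t / T) with (t / (c * (c + 1)) * (c * (c + 1) / T)) by (field; lra).
apply Rmult_le_compat_l; [ | exact h].
apply Rlt_le, Rdiv_lt_0_compat; [lra | apply Rmult_lt_0_compat; lra].
Qed.

(** The exponent [a] stays free: [T / c] serves the lower bound, an arbitrary [a] its sharpness. *)
Lemma is_derive_ln_hyp0F1_minus (c T a t : R) : 0 < c -> t < T -> 0 < T ->
  0 < hyp0F1 c t ->
  is_derive (fun s => ln (hyp0F1 c s) - a * ln (1 - s / T)) t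
    (a / (T - t) - hyp0F1 (c + 1) t / (c * hyp0F1 c t)).
Proof.
intros hc ht hT hp.
assert (hd := is_derive_hyp0F1 c t hc).
assert (h1 : 0 < 1 - t / T).
{ replace (1 - t / T) with ((T - t) / T) by (field; lra).
  apply Rdiv_lt_0_compat; lra. }
auto_derive.
- repeat split; try assumption; eexists; exact hd.
- replace (Derive (fun x => hyp0F1 c x) t) with (- hyp0F1 (c + 1) t / c)
    by (symmetry; apply is_derive_unique, hd).
  field; repeat split; lra.
Qed.

(** The difference of the two sides is 0 at [t = 0], and its derivative is a positive multiple of
    [F_c(s) - F_(c+1)(s) * (1 - s / T)], nonnegative by [hyp0F1_ge_succ]. *)
Lemma hyp0F1_log_lower_bound (c T t : R) : 0 < c -> hyp0F1 c T = 0 ->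
  (forall s, 0 <= s < T -> 0 < hyp0F1 c s) -> 0 <= t < T ->
  T / c * ln (1 - t / T) <= ln (hyp0F1 c t).
Proof.
intros hc hT hpos ht.
assert (h : ln (hyp0F1 c 0) - T / c * ln (1 - 0 / T)
         <= ln (hyp0F1 c t) - T / c * ln (1 - t / T)).
{ apply (le_of_is_derive_nonneg (fun s => ln (hyp0F1 c s) - T / c * ln (1 - s / T))
    (fun s => T / c / (T - s) - hyp0F1 (c + 1) s / (c * hyp0F1 c s))); [lra | | ].
  - intros s hs; apply is_derive_ln_hyp0F1_minus; try apply hpos; lra.
  - intros s hs.
    assert (hp := hpos s ltac:(lra)).
    assert (hk := hyp0F1_ge_succ c T s hc hT hpos ltac:(lra)).
    replace (T / c / (T - s) - hyp0F1 (c + 1) s / (c * hyp0F1 c s))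
      with (T / (c * (T - s) * hyp0F1 c s)
        * (hyp0F1 c s - hyp0F1 (c + 1) s * (1 - s / T))) by (field; lra).
    apply Rmult_le_pos; [ | lra].
    apply Rlt_le, Rdiv_lt_0_compat; [lra | repeat apply Rmult_lt_0_compat; lra]. }
rewrite hyp0F1_0 in h; replace (1 - 0 / T) with 1 in h by (field; lra).
rewrite ln_1 in h; lra.
Qed.

(** * Optimality of the exponents *)

Lemma derive_nonneg_of_right_min (f : R -> R) (l x T : R) : x < T ->
  is_derive f x l -> (forall t, x <= t < T -> f x <= f t) -> 0 <= l.
Proof.
intros hT hd hmin; apply Rnot_lt_le; intros hl.
apply is_derive_Reals in hd.
(* With tolerance [- l] the difference quotient is forced below 0. *)
destruct (hd (- l) ltac:(lra)) as [delta hdelta].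
set (h := Rmin (delta / 2) ((T - x) / 2)).
assert (h0 : 0 < h) by (apply Rmin_pos; destruct delta; simpl; lra).
assert (h1 : h <= delta / 2) by apply Rmin_l.
assert (h2 : h <= (T - x) / 2) by apply Rmin_r.
assert (hlt : Rabs ((f (x + h) - f x) / h - l) < - l).
{ apply hdelta; [lra | rewrite Rabs_right; destruct delta; simpl in *; lra]. }
apply Rabs_def2 in hlt.
specialize (hmin (x + h) ltac:(lra)).
assert (0 <= (f (x + h) - f x) / h) by (apply Rdiv_le_0_compat; lra).
lra.
Qed.

(** The logarithmic difference is 0 at [t = 0] and nonnegative after it, so its derivative there,
    [a / T - 1 / c], is nonnegative. *)
Lemma hyp0F1_log_lower_bound_sharp (c T a : R) : 0 < c -> 0 < T ->
  (forall s, 0 <= s < T -> 0 < hyp0F1 c s) ->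
  (forall t, 0 <= t < T -> a * ln (1 - t / T) <= ln (hyp0F1 c t)) ->
  T / c <= a.
Proof.
intros hc hT hpos ha.
assert (hl := derive_nonneg_of_right_min _ _ 0 T hT
  (is_derive_ln_hyp0F1_minus c T a 0 hc hT hT (hpos 0 ltac:(lra)))).
rewrite !hyp0F1_0 in hl.
assert (h : 0 <= a / (T - 0) - 1 / (c * 1)).
{ apply hl; intros t ht; specialize (ha t ht).
  replace (1 - 0 / T) with 1 by (field; lra); rewrite ln_1; lra. }
apply (Rmult_le_compat_l T) in h; [ | lra].
replace (T * (a / (T - 0) - 1 / (c * 1))) with (a - T / c) in h by (field; lra).
lra.
Qed.

(** For [b > 1] the power [s ^ b] is negligible against [s] near 0. *)
Lemma exponent_le_1_of_linear_le_Rpower (k b : R) : 0 < k ->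
  (forall s, 0 < s <= 1 -> k * s <= Rpower s b) -> b <= 1.
Proof.
intros hk h; apply Rnot_lt_le; intros hb.
(* The witness [s] satisfies [s ^ (b - 1) = k']; [k' < k] gives the contradiction and [k' < 1] keeps
   [s <= 1]. *)
set (k' := Rmin k 1 / 2).
assert (h0 : 0 < Rmin k 1) by (apply Rmin_pos; lra).
assert (hk1 := Rmin_l k 1); assert (hk2 := Rmin_r k 1).
set (s := Rpower k' (/ (b - 1))).
assert (hs : 0 < s) by apply exp_pos.
assert (hs1 : s <= 1).
{ apply exp_le_1.
  assert (ln k' < 0) by (rewrite <- ln_1; apply ln_increasing; unfold k'; lra).
  assert (0 < / (b - 1)) by (apply Rinv_0_lt_compat; lra).
  assert (0 < / (b - 1) * - ln k') by (apply Rmult_lt_0_compat; lra); lra. }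
specialize (h s (conj hs hs1)).
replace b with ((b - 1) + 1) in h by ring.
rewrite Rpower_plus, Rpower_1 in h by exact hs.
apply Rmult_le_reg_r in h; [ | exact hs].
unfold s in h; rewrite Rpower_mult, Rinv_l, Rpower_1 in h by (unfold k'; lra).
unfold k' in h; lra.
Qed.

(** * Transfer from Bessel functions and their first zero *)

Lemma normBesselJ_hyp0F1 (nu x : R) : -1 < nu ->
  normBesselJ nu x = hyp0F1 (nu + 1) (x ^ 2 / 4).
Proof.
intros hnu; unfold normBesselJ, hyp0F1, PSeries; apply Series_ext; intros n.
replace (nu + INR n + 1) with (nu + 1 + INR n) by ring.
rewrite Gamma_add_INR, pow_mult by lra.
replace ((x / 2) ^ 2) with (x ^ 2 / 4) by field.
assert (h1 := INR_fact_lt_0 n); assert (h2 := pochhammer_pos (nu + 1) n ltac:(lra)).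
assert (h3 := Gamma_pos (nu + 1) ltac:(lra)).
unfold hyp0F1_coef; field; lra.
Qed.

Lemma BesselJ_normBesselJ (nu x : R) : -1 < nu -> 0 < x ->
  BesselJ nu x = Rpower (x / 2) nu / Gamma (nu + 1) * normBesselJ nu x.
Proof.
intros hnu hx; unfold BesselJ, normBesselJ; rewrite <- Series_scal_l.
apply Series_ext; intros n.
replace (2 * INR n) with (INR (2 * n)) by (rewrite mult_INR; reflexivity).
rewrite Rpower_plus, Rpower_pow by lra.
assert (h := pos_INR n).
assert (h1 := INR_fact_lt_0 n); assert (h2 := Gamma_pos (nu + INR n + 1) ltac:(lra)).
assert (h3 := Gamma_pos (nu + 1) ltac:(lra)).
field; lra.
Qed.

Lemma normBesselJ_zero_iff (nu x : R) : -1 < nu -> 0 < x ->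
  BesselJ nu x = 0 <-> normBesselJ nu x = 0.
Proof.
intros hnu hx; rewrite BesselJ_normBesselJ by assumption.
split; [intros e | intros ->; ring].
apply Rmult_integral in e as [e | e]; [exfalso | exact e].
revert e; apply Rgt_not_eq, Rdiv_lt_0_compat; [apply exp_pos | apply Gamma_pos; lra].
Qed.

(** Since [F_c(0) = 1], a nonpositive value at [s] would produce a zero in [(0, s]] by the
    intermediate value theorem. *)
Lemma hyp0F1_pos_before_zero (c T s : R) : 0 < c ->
  (forall t, 0 < t < T -> hyp0F1 c t <> 0) -> 0 <= s < T -> 0 < hyp0F1 c s.
Proof.
intros hc hz hs; apply Rnot_le_lt; intros hle.
destruct (IVT_gen (hyp0F1 c) 0 s 0) as [r [hr e]].
- intros r; apply continuity_pt_filterlim, (ex_derive_continuous (hyp0F1 c)).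
  apply ex_derive_hyp0F1, hc.
- rewrite hyp0F1_0, Rmin_right, Rmax_left; lra.
- rewrite Rmin_left, Rmax_right in hr by lra.
  assert (r <> 0) by (intros ->; rewrite hyp0F1_0 in e; lra).
  apply (hz r); [lra | exact e].
Qed.

Theorem theorem1 (nu j : R) (hnu : -1 < nu)
    (hj : is_first_positive_zero (BesselJ nu) j) :
  let alpha_nu := j ^ 2 / (4 * (nu + 1)) in
  let beta_nu := 1 in
  (forall x : R, Rabs x < j ->
     Rpower ((j ^ 2 - x ^ 2) / j ^ 2) alpha_nu <= normBesselJ nu x
     /\ normBesselJ nu x <= Rpower ((j ^ 2 - x ^ 2) / j ^ 2) beta_nu)
  /\ is_smallest
       (fun alpha : R => forall x : R, Rabs x < j ->
          Rpower ((j ^ 2 - x ^ 2) / j ^ 2) alpha <= normBesselJ nu x)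
       alpha_nu
  /\ is_largest
       (fun beta : R => forall x : R, Rabs x < j ->
          normBesselJ nu x <= Rpower ((j ^ 2 - x ^ 2) / j ^ 2) beta)
       beta_nu.
Proof.
intros alpha_nu beta_nu.
destruct hj as [hj0 [hj1 hj2]].
set (c := nu + 1); assert (hc : 0 < c) by (unfold c; lra).
set (T := j ^ 2 / 4).
assert (hT0 : 0 < T) by (assert (h := pow_lt j 2 hj0); unfold T; lra).
assert (hT : hyp0F1 c T = 0).
{ apply normBesselJ_zero_iff in hj1; [ | assumption ..].
  rewrite normBesselJ_hyp0F1 in hj1; assumption. }
assert (hlt : forall x, Rabs x < j -> 0 <= x ^ 2 / 4 < T).
{ intros x hx; assert (h := pow2_ge_0 x).
  assert (x ^ 2 < j ^ 2).
  { rewrite <- (pow2_abs x); assert (hx0 := Rabs_pos x).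
    simpl; apply Rmult_le_0_lt_compat; lra. }
  unfold T; lra. }
(* The point [x = 2 * sqrt t] inverts [t = x ^ 2 / 4], so a bound for all [|x| < j] yields one for
   all [t] in [[0, T)]. *)
assert (hsqrt : forall t, 0 <= t < T -> Rabs (2 * sqrt t) < j /\ (2 * sqrt t) ^ 2 / 4 = t).
{ intros t ht; assert (e := pow2_sqrt t (proj1 ht)).
  assert (e2 : (2 * sqrt t) ^ 2 / 4 = t) by (rewrite Rpow_mult_distr; lra).
  split; [ | exact e2].
  assert (h := sqrt_pos t); rewrite Rabs_right by lra.
  apply Rnot_le_lt; intros hle.
  assert (hp := pow_incr j (2 * sqrt t) 2 ltac:(lra)); unfold T in ht; lra. }
assert (hpos : forall s, 0 <= s < T -> 0 < hyp0F1 c s).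
{ intros s; apply (hyp0F1_pos_before_zero c T s hc); intros t ht e.
  destruct (hsqrt t ltac:(lra)) as [h1 h2].
  assert (h3 := sqrt_lt_R0 t (proj1 ht)); rewrite Rabs_right in h1 by lra.
  assert (h4 : BesselJ nu (2 * sqrt t) = 0).
  { apply normBesselJ_zero_iff; [lra .. | ].
    rewrite normBesselJ_hyp0F1, h2 by lra; exact e. }
  specialize (hj2 (2 * sqrt t) ltac:(lra) h4); lra. }
assert (hbase : forall x, (j ^ 2 - x ^ 2) / j ^ 2 = 1 - x ^ 2 / 4 / T)
  by (intros x; unfold T; field; lra).
assert (hbase_pos : forall t, 0 <= t < T -> 0 < 1 - t / T).
{ intros t ht; replace (1 - t / T) with ((T - t) / T) by (field; lra).
  apply Rdiv_lt_0_compat; lra. }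
assert (halpha : alpha_nu = T / c) by (unfold alpha_nu, T, c; field; lra).
assert (hlower : forall x, Rabs x < j ->
  Rpower ((j ^ 2 - x ^ 2) / j ^ 2) alpha_nu <= normBesselJ nu x).
{ intros x hx; apply hlt in hx.
  rewrite hbase, halpha, normBesselJ_hyp0F1 by exact hnu; fold c.
  rewrite <- (exp_ln (hyp0F1 c (x ^ 2 / 4))) by (apply hpos, hx).
  destruct (hyp0F1_log_lower_bound c T _ hc hT hpos hx) as [h | h];
    unfold Rpower; [left; apply exp_increasing, h | right; rewrite h; reflexivity]. }
assert (hupper : forall x, Rabs x < j ->
  normBesselJ nu x <= Rpower ((j ^ 2 - x ^ 2) / j ^ 2) beta_nu).
{ intros x hx; apply hlt in hx; unfold beta_nu.
  rewrite hbase, Rpower_1, normBesselJ_hyp0F1; [ | exact hnu | apply hbase_pos, hx].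
  apply hyp0F1_upper_bound; assumption. }
split; [intros x hx; split; auto | split; split; [exact hlower | | exact hupper | ]].
- intros a ha; rewrite halpha.
  apply (hyp0F1_log_lower_bound_sharp c T a hc hT0 hpos); intros t ht.
  destruct (hsqrt t ht) as [h1 h2]; specialize (ha _ h1).
  rewrite hbase, normBesselJ_hyp0F1, h2 in ha by exact hnu; fold c in ha.
  rewrite <- ln_Rpower; apply ln_le; [apply exp_pos | exact ha].
- intros b hb.
  (* In the variable [s = 1 - t / T] this constant is the slope at [s = 0] of the tangent to [F_c]
     at its zero. *)
  apply (exponent_le_1_of_linear_le_Rpower (T * hyp0F1 (c + 1) T / c)).
  + assert (0 < hyp0F1 (c + 1) T) by (apply hyp0F1_succ_pos; [lra .. | exact hpos]).
    apply Rdiv_lt_0_compat; [apply Rmult_lt_0_compat | ]; assumption.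
  + intros s hs.
    assert (ht : 0 <= T * (1 - s) < T).
    { assert (0 < T * s) by (apply Rmult_lt_0_compat; lra).
      assert (0 <= T * (1 - s)) by (apply Rmult_le_pos; lra); lra. }
    destruct (hsqrt _ ht) as [h1 h2]; specialize (hb _ h1).
    rewrite hbase, normBesselJ_hyp0F1, h2 in hb by exact hnu; fold c in hb.
    replace (1 - T * (1 - s) / T) with s in hb by (field; lra).
    assert (h := hyp0F1_linear_lower_bound c T _ hc hT hpos ht).
    replace (hyp0F1 (c + 1) T / c * (T - T * (1 - s)))
      with (T * hyp0F1 (c + 1) T / c * s) in h by (field; lra).
    lra.
Qed.
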